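(* Let $G=(V,E)$ be a connected undirected graph on $n$ vertices with positive integer edge weights $w$ and a unique minimum spanning tree $Z$. Let $k\ge 2$ be an integer, $\varepsilon>0$, and $t=(2k-1)(1+\varepsilon)$. Let $H$ be the output of the greedy algorithm with parameter $t$. Order the vertices $v_1,\dots,v_n$ as they are visited by a preorder traversal of $Z$ from some root, and let $L=\sum_{j=2}^n d_Z(v_{j-1},v_j)$. For $i\in\{1,\dots,\lceil\log_k n\rceil\}$ let \[ E_i=\{e\in E(H)\setminus E(Z)\;:\; w(e)\in (k^{i-1},k^i]\cdot L/n\}. \] Then for every such $i$, \[ w(E_i)\le O\!\left(L\cdot (n/k^{i-1})^{1/k}/\varepsilon^{1+1/k}\right), \] with an absolute constant in the $O(\cdot)$.
   Context: The greedy algorithm with parameter $t$: start with $H=(V,\emptyset)$; process the edges $\{u,v\}\in E$ in non-decreasing order of weight, and add $\{u,v\}$ to $E(H)$ if and only if, at that moment, $d_H(u,v)>t\cdot w(u,v)$ (where $d_H$ is the weighted shortest-path distance in the current $H$, $\infty$ if disconnected). $d_Z$ is the weighted shortest-path distance in the tree $Z$. For a set of edges $F$, $w(F)=\sum_{e\in F}w(e)$. *)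

(* Defs.v *)
From Stdlib Require Import Reals ClassicalEpsilon.
From mathcomp Require Import all_boot.

Delimit Scope R_scope with Re.

Set Implicit Arguments.
Unset Strict Implicit.
Unset Printing Implicit Defensive.

Section Graphs.
Variable T : finType.

(* An undirected edge is a 2-element set {u,v}; an edge set is a set of them. *)
Definition adj (F : {set {set T}}) : rel T := fun u v => [set u; v] \in F.

Definition walk_w (w : {set T} -> nat) (u : T) (p : seq T) : nat :=
  sumn (pairmap (fun a b => w [set a; b]) u p).

Definition wset (w : {set T} -> nat) (F : {set {set T}}) : nat :=
  \sum_(e in F) w e.

(* d_F(u,v) > x  (with d_F(u,v) = +oo when u,v are disconnected in F) *)
Definition dist_gt (F : {set {set T}}) (w : {set T} -> nat) (u v : T) (x : R) : Prop :=
  forall p : seq T, path (adj F) u p -> last u p = v -> (x < INR (walk_w w u p))%Re.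

Definition walk_of_weight (F : {set {set T}}) (w : {set T} -> nat) (u v : T) (d : nat) : Prop :=
  exists p : seq T, [/\ path (adj F) u p, last u p = v & walk_w w u p = d].

Definition walk_of_weightb F w u v d : bool :=
  if excluded_middle_informative (walk_of_weight F w u v d) then true else false.

Lemma dist_ex F w u v :
  (exists d, walk_of_weight F w u v d) -> exists d, walk_of_weightb F w u v d.
Proof.
case=> d hd; exists d; rewrite /walk_of_weightb.
by case: excluded_middle_informative.
Qed.

(* Weighted shortest-path distance d_F(u,v) (only used when u,v are connected;
   it is 0 by convention otherwise). *)
Definition wdist (F : {set {set T}}) (w : {set T} -> nat) (u v : T) : nat :=
  match excluded_middle_informative (exists d, walk_of_weight F w u v d) with
  | left h => ex_minn (dist_ex h)
  | right _ => 0
  end.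

Definition acyclic (F : {set {set T}}) : Prop :=
  forall u v, [set u; v] \in F -> ~~ connect (adj (F :\ [set u; v])) u v.

Definition spanning_tree (E Z : {set {set T}}) : Prop :=
  [/\ Z \subset E, (forall u v, connect (adj Z) u v) & acyclic Z].

Definition unique_mst (E : {set {set T}}) (w : {set T} -> nat) (Z : {set {set T}}) : Prop :=
  spanning_tree E Z /\
  forall Z', spanning_tree E Z' -> Z' <> Z -> (wset w Z < wset w Z')%N.

Definition greedy_order (E : {set {set T}}) (w : {set T} -> nat) (s : seq (T * T)) : Prop :=
  perm_eq [seq [set p.1; p.2] | p <- s] (enum E) /\
  sorted (fun p q : T * T => (w [set p.1; p.2] <= w [set q.1; q.2])%N) s.

Definition greedy_step (w : {set T} -> nat) (t : R) (H : {set {set T}}) (p : T * T)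
  : {set {set T}} :=
  if excluded_middle_informative (dist_gt H w p.1 p.2 (t * INR (w [set p.1; p.2]))%Re)
  then [set p.1; p.2] |: H else H.

Definition greedy (w : {set T} -> nat) (t : R) (s : seq (T * T)) : {set {set T}} :=
  foldl (greedy_step w t) set0 s.

Definition on_path (Z : {set {set T}}) (r v u : T) : Prop :=
  exists p : seq T, [/\ path (adj Z) r p, last r p = v, uniq (r :: p) & u \in r :: p].

(* s is a preorder (DFS) traversal of the tree Z rooted at r: it lists every
   vertex once, starts at r, and each later vertex's parent (its Z-neighbour on
   the r-path) lies on the r-path of the previously visited vertex. *)
Definition preorder (Z : {set {set T}}) (r : T) (s : seq T) : Prop :=
  [/\ perm_eq s (enum T), head r s = r &
      forall j, (0 < j < size s)%N ->
        exists u, [/\ adj Z u (nth r s j), on_path Z r (nth r s j) u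
                    & on_path Z r (nth r s j.-1) u]].

Definition Rltb (x y : R) : bool := if Rlt_dec x y then true else false.
Definition Rleb (x y : R) : bool := if Rle_dec x y then true else false.

End Graphs.

(* Main.v *)
Require Import Defs.
From Stdlib Require Import Reals ZArith Lra Lia ClassicalEpsilon.
From mathcomp Require Import all_boot.

(** Place the vertices on a line of length [L] by their prefix sums along the
tour; distances on the line dominate distances in [Z].  Let [W = k^(i-1) L / n]
and cut the line into clusters of width [eps W / 4], [O(n / (k^(i-1) eps))] of
them.  An edge of [E_i] of weight about [a W] becomes [a] parallel edges between
clusters, the [j]-th one with both ends shifted by [j] clusters; a shift costs
at most [eps / 4] times the weight of the edge.  The resulting cluster graph has
no cycle with at most [2k] edges: at a heaviest original edge such a cycle would
be a detour of stretch at most [(2k - 1) (1 + eps)] in [H], which contains [Z]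
because the minimum spanning tree is unique.  The Moore bound therefore bounds
the number of its edges, which is [w(E_i) / W] up to a factor [2]. *)

Set Implicit Arguments.
Unset Strict Implicit.
Unset Printing Implicit Defensive.

(** * Walks, the greedy algorithm and the minimum spanning tree *)

Section Reach.
Variables (T : finType) (w : {set T} -> nat).
Implicit Types (F : {set {set T}}) (a b c : T) (x y : R).

Lemma adjC F a b : adj F a b = adj F b a.
Proof. by rewrite /adj setUC. Qed.

Lemma adj_sub F F' : F \subset F' -> subrel (adj F) (adj F').
Proof. by move=> /subsetP sub a b; apply: sub. Qed.

Lemma connect_adjC F a b : connect (adj F) a b = connect (adj F) b a.
Proof. by apply: sym_connect_sym; apply: adjC. Qed.

(** The complement of [dist_gt]. It is monotone in the bound and additive under concatenation, so
    detours can be assembled without computing distances. *)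
Definition reach F a b x : Prop :=
  exists p, [/\ path (adj F) a p, last a p = b & (INR (walk_w w a p) <= x)%Re].

Lemma dist_gtP F a b x : dist_gt F w a b x <-> ~ reach F a b x.
Proof.
split=> [gt [p [pp lp le]] | nr p pp lp].
  by have := gt p pp lp; lra.
by case: (Rlt_le_dec x (INR (walk_w w a p))) => // le; case: nr; exists p.
Qed.

Lemma reach_refl F a x : (0 <= x)%Re -> reach F a a x.
Proof. by move=> x0; exists [::]; split. Qed.

Lemma reach_mono F F' a b x y :
  F \subset F' -> (x <= y)%Re -> reach F a b x -> reach F' a b y.
Proof.
move=> sub le [p [pp lp lex]]; exists p; split=> //; last lra.
exact: sub_path (adj_sub sub) _ _ pp.
Qed.

Lemma walk_w_cat a p q :
  walk_w w a (p ++ q) = walk_w w a p + walk_w w (last a p) q.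
Proof. by rewrite /walk_w pairmap_cat sumn_cat. Qed.

Lemma reach_trans F a b c x y :
  reach F a b x -> reach F b c y -> reach F a c (x + y)%Re.
Proof.
move=> [p [pp lp lex]] [q [pq lq ley]]; exists (p ++ q).
rewrite cat_path pp last_cat lp pq lq walk_w_cat lp plus_INR; split=> //; lra.
Qed.

Lemma reach_edge F a b : [set a; b] \in F -> reach F a b (INR (w [set a; b])).
Proof.
move=> Fab; exists [:: b]; rewrite /= /adj Fab /walk_w /= addn0.
by split=> //; apply: Rle_refl.
Qed.

Lemma reach_sym F a b x : reach F a b x -> reach F b a x.
Proof.
case=> p; elim: p a x => [|c p IH] a x [/= pp lp le].
  by exists [::]; split=> //; rewrite lp.
case/andP: pp => Fac pp; rewrite /walk_w /= plus_INR in le.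
have rc := IH c _ (And3 pp lp (Rle_refl _)).
have ca : reach F c a (INR (w [set a; c])).
  by rewrite setUC; apply: reach_edge; rewrite setUC.
by apply: reach_mono (reach_trans rc ca) => //; rewrite /walk_w; lra.
Qed.

Lemma reach_connect F a b x : reach F a b x -> connect (adj F) a b.
Proof. by case=> p [pp lp _]; apply/connectP; exists p. Qed.

Lemma wdistP F a b : connect (adj F) a b ->
  reach F a b (INR (wdist F w a b)) /\
  (forall p, path (adj F) a p -> last a p = b -> wdist F w a b <= walk_w w a p).
Proof.
move=> /connectP [p pp lp]; rewrite /wdist.
case: excluded_middle_informative => /= [h|[]]; last first.
  by exists (walk_w w a p), p.
case: ex_minnP => d; rewrite {1}/walk_of_weightb.
case: excluded_middle_informative => // -[q [pq lq eqd]] _ min; split.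
  by exists q; split=> //; rewrite eqd; apply: Rle_refl.
move=> p' pp' lp'; apply: min; rewrite /walk_of_weightb.
by case: excluded_middle_informative => // -[]; exists p'.
Qed.

Lemma wdist_triangle F a b c : (forall u v, connect (adj F) u v) ->
  wdist F w a c <= wdist F w a b + wdist F w b c.
Proof.
move=> con.
have [[p [pp lp /INR_le/leP le1]] _] := wdistP (con a b).
have [[q [pq lq /INR_le/leP le2]] _] := wdistP (con b c).
apply: leq_trans (leq_add le1 le2).
rewrite -[in X in _ + X]lp -walk_w_cat.
by apply: (wdistP (con a c)).2; rewrite ?cat_path ?last_cat lp ?pp.
Qed.

Lemma wdist_self F a : wdist F w a a = 0.
Proof.
by apply/eqP; rewrite -leqn0; apply: (wdistP (connect0 _ a)).2 [::] _ _.
Qed.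

Lemma wdistC F a b : (forall u v, connect (adj F) u v) ->
  wdist F w a b = wdist F w b a.
Proof.
move=> con; apply/eqP; rewrite eqn_leq.
have half u v : wdist F w u v <= wdist F w v u.
  have [/reach_sym [p [pp lp /INR_le/leP le]] _] := wdistP (con v u).
  by apply: leq_trans le; apply: (wdistP (con u v)).2.
by rewrite !half.
Qed.

Lemma set2_eqP a b c d : [set a; b] = [set c; d] ->
  (a = c /\ b = d) \/ (a = d /\ b = c).
Proof.
move=> eq; have := set21 a b; have := set22 a b; rewrite eq => /set2P hb /set2P ha.
have := set21 c d; have := set22 c d; rewrite -eq => /set2P hd /set2P hc.
by case: ha => ha; case: hb => hb; subst; auto; case: hc; case: hd; auto.
Qed.

(* Only the first and the last use of the edge a0 b0 matter: everything between
   them can be skipped, leaving no use or a single use of that edge. *)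
Lemma reach_remove F a0 b0 a b x :
  reach ([set a0; b0] |: F) a b x ->
  reach F a b x \/
  exists c d y z, [/\ [set c; d] = [set a0; b0], reach F a c y, reach F d b z
    & (y + INR (w [set a0; b0]) + z <= x)%Re].
Proof.
case=> p; elim: p a x => [|c p IH] a x [/= pp lp le].
  by left; exists [::].
case/andP: pp => Fac pp; rewrite /walk_w /= plus_INR in le.
have w0 e : (0 <= INR (w e))%Re by apply: pos_INR.
have x0 : (0 <= x)%Re.
  by apply: Rle_trans le; have := w0 [set a; c];
     have := pos_INR (sumn (pairmap (fun a b => w [set a; b]) c p)); lra.
have {}IH := IH c _ (And3 pp lp (Rle_refl _)).
move: Fac; rewrite /adj in_setU1 => /orP [/eqP gac|Fac].
  case: IH => [r|[c' [d [y [z [g r1 r2 le2]]]]]].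
    right; exists a, c, 0%Re, (INR (walk_w w c p)).
    split=> //; first by apply: reach_refl; apply: Rle_refl.
    by rewrite -gac /walk_w; lra.
  have y0 : (0 <= y)%Re.
    by case: r1 => q [_ _ leq]; have := pos_INR (walk_w w c' q);
       have := pos_INR (walk_w w c q); lra.
  have := w0 [set a0; b0]; rewrite /walk_w in le2; rewrite gac in le => w00.
  case: (set2_eqP (etrans g (esym gac))) => -[e1 e2]; subst.
    right; exists a, c, 0%Re, z; split=> //; last lra.
    by apply: reach_refl; apply: Rle_refl.
  by left; apply: reach_mono r2 => //; lra.
have ra := reach_edge Fac.
case: IH => [r|[c' [d [y [z [g r1 r2 le2]]]]]].
  by left; apply: reach_mono (reach_trans ra r) => //; rewrite /walk_w; lra.
right; exists c', d, (INR (w [set a; c]) + y)%Re, z; split=> //.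
  exact: reach_trans ra r1.
by rewrite /walk_w in le2; lra.
Qed.

End Reach.

(** * Detours in the output of the greedy algorithm *)

Section Greedy.
Variables (T : finType) (w : {set T} -> nat) (t : R).
Implicit Types (s : seq (T * T)) (p : T * T).

Local Notation edge p := [set p.1; p.2].

Lemma greedy_rcons s p : greedy w t (rcons s p) = greedy_step w t (greedy w t s) p.
Proof. by rewrite /greedy -cats1 foldl_cat. Qed.

Lemma greedy_sub s : greedy w t s \subset [set edge p | p in s].
Proof.
elim/last_ind: s => [|s p IH]; first by rewrite sub0set.
have sub : greedy w t s \subset [set edge q | q in rcons s p].
  apply: subset_trans IH _; apply: imsetS; apply/subsetP=> q qs.
  by rewrite mem_rcons in_cons qs orbT.
rewrite greedy_rcons /greedy_step; case: excluded_middle_informative => /= _ //.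
by rewrite subUset sub1set sub andbT; apply/imsetP; exists p; rewrite ?mem_rcons ?mem_head.
Qed.

Lemma greedy_cat_sub s s' : greedy w t s \subset greedy w t (s ++ s').
Proof.
elim/last_ind: s' => [|s' p IH]; first by rewrite cats0.
rewrite -rcons_cat greedy_rcons /greedy_step.
by case: excluded_middle_informative => /= _ //; apply: subset_trans IH (subsetUr _ _).
Qed.

(** The critical case is a detour of an old edge e through the newly added edge p. The rest of this
    detour together with e joins the ends of p without using p, at weight at most t w(e) - w(p) +
    w(e). Since w(e) <= w(p), this is at most t w(p), and p would have been rejected. *)
Lemma greedy_girth s : (1 <= t)%Re ->
  sorted (fun p q => w (edge p) <= w (edge q)) s ->
  forall u v, [set u; v] \in greedy w t s ->
  ~ reach w (greedy w t s :\ [set u; v]) u v (t * INR (w [set u; v])).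
Proof.
move=> t1; elim/last_ind: s => [|s p IH] srt u v; first by rewrite inE.
have tr : transitive (fun p q : T * T => w (edge p) <= w (edge q)).
  by move=> ? ? ?; apply: leq_trans.
have {}IH : forall u v, [set u; v] \in greedy w t s ->
  ~ reach w (greedy w t s :\ [set u; v]) u v (t * INR (w [set u; v])).
  by apply: IH; move: srt; rewrite -cats1 => /cat_sorted2 [].
have lew e : e \in greedy w t s -> w e <= w (edge p).
  move=> /(subsetP (greedy_sub s)) /imsetP [q qs ->].
  move: srt; rewrite (sorted_pairwise tr) pairwise_rcons => /andP [/allP al _].
  exact: al.
rewrite greedy_rcons /greedy_step; case: excluded_middle_informative => /= [gt|_]; last exact: IH.
have {gt} nr := (dist_gtP _ _ _ _ _).1 gt.
move: (greedy w t s) IH lew nr => H IH lew nr.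
have [eq _ r|neq] := eqVneq [set u; v] (edge p).
  have {}r : reach w H u v (t * INR (w (edge p))).
    rewrite -eq; apply: reach_mono r => //; last exact: Rle_refl.
    by rewrite eq subDset.
  move: r nr; set x := (t * _)%Re => r; case.
  by case: (set2_eqP eq) => -[<- <-] //; apply: reach_sym.
rewrite in_setU1 (negPf neq) /= => He.
have sub : (edge p |: H) :\ [set u; v] \subset edge p |: (H :\ [set u; v]).
  by rewrite setDUl setSU // subsetDl.
move=> /(reach_mono sub (Rle_refl _)) /reach_remove [|]; first exact: IH.
have sub' := subsetDl H [set [set u; v]].
case=> c [d [y [z [g]]]] /(reach_mono sub' (Rle_refl _)) r1.
move=> /(reach_mono sub' (Rle_refl _)) r2 le; apply: nr.
have r := reach_trans (reach_trans (reach_sym r1) (reach_edge w He)) (reach_sym r2).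
have {}r : reach w H c d (t * INR (w (edge p))).
  apply: reach_mono r => //; have /leP/le_INR lewe := lew _ He.
  have := Rmult_le_compat_l t _ _ ltac:(lra) lewe; lra.
move: r; set x := (t * _)%Re => r.
by case: (set2_eqP g) => -[<- <-] //; apply: reach_sym.
Qed.
End Greedy.

(** * Edge exchange in the minimum spanning tree *)

Section MinimumSpanningTree.
Variables (T : finType) (w : {set T} -> nat).
Implicit Types (E F Z : {set {set T}}).

Definition connected_by F := forall u v, connect (adj F) u v.

Lemma connected_by_split Z u v : connected_by Z -> forall y,
  connect (adj (Z :\ [set u; v])) u y || connect (adj (Z :\ [set u; v])) v y.
Proof.
move=> con y; have /connectP [p pp ->] := con u y.
pose P a := connect (adj (Z :\ [set u; v])) u a || connect (adj (Z :\ [set u; v])) v a.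
suff step a : P a -> path (adj Z) a p -> P (last a p) by apply: step; rewrite /P ?connect0.
elim: p a {pp} => //= b p IH a ha /andP [ab pp]; apply: IH => //; rewrite /P.
have [eq|neq] := eqVneq [set a; b] [set u; v].
  by case: (set2_eqP eq) => -[_ ->]; rewrite connect0 ?orbT.
have /connect1 st : adj (Z :\ [set u; v]) a b by rewrite /adj in_setD1 neq.
by case/orP: ha => /connect_trans /(_ st) ->; rewrite ?orbT.
Qed.

(** An inclusion-minimal connecting subset works: deleting an edge whose ends stay joined would
    leave it connecting. *)
Lemma connected_by_subtree F : connected_by F ->
  exists Z, [/\ Z \subset F, connected_by Z & acyclic Z].
Proof.
move=> con.
pose P (Z : {set {set T}}) := [forall u, forall v, connect (adj Z) u v].
have PF : P F by apply/forallP=> u; apply/forallP.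
have [Z /minsetP [/forallP PZ min] sub] := minset_exists PF.
exists Z; split=> // [u v|u v Zuv]; first by have /forallP := PZ u.
apply/negP => cuv.
suff /min eq : P (Z :\ [set u; v]).
  by move: Zuv; rewrite -eq ?subD1set // in_setD1 eqxx.
apply/forallP=> a; apply/forallP=> b; have /forallP /(_ b) := PZ a.
apply: connect_sub => {}a {}b ab.
have [eq|neq] := eqVneq [set a; b] [set u; v].
  by case: (set2_eqP eq) => -[-> ->]; rewrite 1?connect_adjC // connect_adjC.
by apply: connect1; rewrite /adj in_setD1 neq.
Qed.

(** Deleting the edge from [Z] leaves two sides, and a walk in [F] from [u] to [v] crosses between
    them. Exchanging the deleted edge for the crossing one, which is no heavier, contradicts
    uniqueness of the minimum. *)
Lemma unique_mst_bottleneck E Z F u v : unique_mst E w Z -> [set u; v] \in Z ->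
  F \subset E -> [set u; v] \notin F -> (forall e, e \in F -> w e <= w [set u; v]) ->
  ~~ connect (adj F) u v.
Proof.
move=> [[ZE con acy] uniq] Ze FE eF lew; apply/negP => /connectP [p pp lp].
pose Z1 := Z :\ [set u; v].
have nuv : ~~ connect (adj Z1) u v by apply: acy.
have [x [y [Fxy ux uy]]] : exists x y, [/\ [set x; y] \in F,
    connect (adj Z1) u x & ~~ connect (adj Z1) u y].
  suff step a : connect (adj Z1) u a -> path (adj F) a p -> last a p = v ->
      exists x y, [/\ [set x; y] \in F, connect (adj Z1) u x & ~~ connect (adj Z1) u y].
    exact: step (connect0 _ _) pp (esym lp).
  elim: p a {pp lp} => [a ua _ /= lp|b p IH a ua /= /andP [ab pp] lp].
    by move: nuv; rewrite -lp ua.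
  have [ub|nub] := boolP (connect (adj Z1) u b); first exact: IH ub pp lp.
  by exists a, b.
have vy : connect (adj Z1) v y.
  by have := connected_by_split u v con y; rewrite (negPf uy).
pose Y := [set x; y] |: Z1.
have subY : subrel (adj Z1) (connect (adj Y)).
  by move=> a b ab; apply: connect1; apply: adj_sub ab; apply: subsetUr.
have liftY a b : connect (adj Z1) a b -> connect (adj Y) a b.
  exact: connect_sub.
have Yuv : connect (adj Y) u v.
  apply: connect_trans (liftY _ _ ux) _.
  apply: (@connect_trans _ _ y); last by rewrite connect_adjC; apply: liftY.
  by apply: connect1; rewrite /adj setU11.
have conY : connected_by Y.
  move=> a b; apply: connect_sub (con a b) => {}a {}b ab.
  have [eq|neq] := eqVneq [set a; b] [set u; v].
    by case: (set2_eqP eq) => -[-> ->] //; rewrite connect_adjC.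
  by apply: subY; rewrite /adj in_setD1 neq.
(* Passing to a spanning subtree of [Y] avoids a proof that [Y] is acyclic; the subtree still misses
   the edge [[set u; v]] and weighs no more than [Y]. *)
have [Z' [Z'Y con' acy']] := connected_by_subtree conY.
have eY : [set u; v] \notin Y.
  rewrite in_setU1 setD11 orbF; apply: contraNneq eF => ->; exact: Fxy.
have Z'E : Z' \subset E.
  apply: subset_trans Z'Y _; rewrite subUset sub1set (subsetP FE) //=.
  exact: subset_trans (subD1set _ _) ZE.
have neqZ : Z' <> Z.
  by move=> eq; move: eY; rewrite (subsetP Z'Y) // eq.
have := uniq Z' (And3 Z'E con' acy') neqZ; rewrite ltnNge => /negP; apply.
have wsub (A B : {set {set T}}) : A \subset B -> wset w A <= wset w B.
  move=> AB; rewrite /wset [X in _ <= X](big_setID A) /=.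
  by rewrite (setIidPr AB) leq_addr.
apply: leq_trans (wsub _ _ Z'Y) _.
rewrite {2}/wset (big_setD1 [set u; v]) //=.
apply: (@leq_trans (w [set x; y] + wset w Z1)); last by rewrite leq_add2r lew.
have [i|ni] := boolP ([set x; y] \in Z1); last by rewrite /wset big_setU1.
by have -> : Y = Z1; [apply/setUidPr; rewrite sub1set | apply: leq_addl].
Qed.

(** When a tree edge is processed, the current graph consists of other edges that are no heavier. By
    the bottleneck property its ends are still disconnected, so it is added whatever [t] is. *)
Lemma mst_sub_greedy E Z (t : R) s : unique_mst E w Z -> greedy_order E w s ->
  Z \subset greedy w t s.
Proof.
move=> mst [perm srt]; apply/subsetP => e Ze.
have [[ZE _ _] _] := mst.
have memE f : (f \in [seq [set p.1; p.2] | p <- s]) = (f \in E).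
  by rewrite (perm_mem perm) mem_enum.
have : e \in [seq [set p.1; p.2] | p <- s] by rewrite memE (subsetP ZE).
case/mapP => g gs def_e; case/splitPr: gs => s1 s2 in perm srt memE *.
suff : e \in greedy w t (rcons s1 g).
  by apply: subsetP; rewrite -cat_rcons; apply: greedy_cat_sub.
rewrite greedy_rcons /greedy_step def_e.
case: excluded_middle_informative => /= [_|]; first exact: setU11.
move=> ngt; exfalso; apply: ngt; apply/dist_gtP => /reach_connect.
apply/negP; apply: (unique_mst_bottleneck mst); rewrite -?def_e //.
- apply/subsetP => f /(subsetP (greedy_sub _ _ _)) /imsetP [q qs ->].
  by rewrite -memE map_cat mem_cat; apply/orP; left; apply/mapP; exists q.
- apply/negP => /(subsetP (greedy_sub _ _ _)) /imsetP [q qs eq].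
  have e1 : e \in [seq [set p.1; p.2] | p <- s1] by apply/mapP; exists q.
  have := enum_uniq E; rewrite -(perm_uniq perm) map_cat cat_uniq /= -def_e.
  by rewrite e1 andbF.
- move=> f /(subsetP (greedy_sub _ _ _)) /imsetP [q qs ->].
  have tr : transitive (fun p q : T * T => w [set p.1; p.2] <= w [set q.1; q.2]).
    by move=> ? ? ?; apply: leq_trans.
  move: srt; rewrite (sorted_pairwise tr) pairwise_cat => /and3P [/allrelP al _ _].
  by rewrite def_e; apply: al; rewrite ?mem_head.
Qed.

End MinimumSpanningTree.

(** * The Moore bound *)

Section Moore.
Variables (B V : finType) (ends : bool -> B -> V).
Implicit Types (A : {set B}) (d : B * bool) (S : {set V}).

(* A dart is an edge with a direction: (b, c) runs from ends c b to ends (~~ c) b. *)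
Definition dart_src d := ends d.2 d.1.
Definition dart_tgt d := ends (~~ d.2) d.1.
Definition dart_rev d := (d.1, ~~ d.2).

Definition dart_next A d d' : bool :=
  [&& dart_tgt d == dart_src d', d.1 != d'.1 & d'.1 \in A].

(** A cycle is a closed walk whose consecutive edges differ; [d] and [p] together have at most [l]
    edges. A loop is a cycle with one edge, two parallel edges form one with two. *)
Definition no_short_cycle A l := forall d p,
  d.1 \in A -> path (dart_next A) d p -> size p < l ->
  dart_src d <> dart_tgt (last d p).

Lemma sub_dart_next A A' : A \subset A' -> subrel (dart_next A) (dart_next A').
Proof. by move=> /subsetP sub d d' /and3P [e n m]; rewrite /dart_next e n sub. Qed.

Lemma no_short_cycle_sub A A' l :
  A \subset A' -> no_short_cycle A' l -> no_short_cycle A l.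
Proof.
move=> sub cyc d p dA pp; apply: cyc; first exact: (subsetP sub).
exact: sub_path (sub_dart_next sub) _ _ pp.
Qed.

Lemma dart_tgt_rev d : dart_tgt (dart_rev d) = dart_src d.
Proof. by rewrite /dart_tgt /= negbK. Qed.

Lemma path_dart_rev A d p : d.1 \in A -> path (dart_next A) d p ->
  (last d p).1 \in A /\
  path (dart_next A) (dart_rev (last d p)) (map dart_rev (rev (belast d p))).
Proof.
elim: p d => [|d' p IH] d dA //= /andP [/and3P [e n d'A] pp].
have [lA pr] := IH d' d'A pp; split=> //.
rewrite rev_cons map_rcons rcons_path pr /=.
have -> : last (dart_rev (last d' p)) (map dart_rev (rev (belast d' p))) = dart_rev d'.
  rewrite last_map; congr dart_rev; case: p {IH pp lA pr} => //= d2 p.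
  by rewrite rev_cons last_rcons.
by rewrite /dart_next dart_tgt_rev eq_sym /dart_src /= e eq_sym n.
Qed.

Fixpoint reachable A l d : {set V} :=
  if l is l'.+1 then \bigcup_(d' | dart_next A d d') reachable A l' d'
  else [set dart_tgt d].

Lemma reachableP A l d y : y \in reachable A l d ->
  exists p, [/\ path (dart_next A) d p, size p = l & y = dart_tgt (last d p)].
Proof.
elim: l d => [|l IH] d /=; first by move=> /set1P ->; exists [::].
by case/bigcupP=> d' nx /IH [p [pp sp ->]]; exists (d' :: p); rewrite /= nx pp sp.
Qed.

Lemma card_bigcup_disjoint (I : finType) (P : pred I) (F : I -> {set V}) :
  (forall i j y, P i -> P j -> y \in F i -> y \in F j -> i = j) ->
  #|\bigcup_(i | P i) F i| = \sum_(i | P i) #|F i|.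
Proof.
move=> inj; pose F' i := if P i then F i else set0.
have memF' i y : (y \in F' i) = P i && (y \in F i).
  by rewrite /F'; case: ifP => // _; rewrite inE.
rewrite big_mkcond -/F' -sum1_card partition_disjoint_bigcup => [|i j neq]; last first.
  apply/pred0P => y /=; rewrite !memF'; apply/negP => /andP [/andP [Pi yi] /andP [Pj yj]].
  by rewrite (inj i j y) ?eqxx in neq.
rewrite [RHS]big_mkcond; apply: eq_bigr => i _; rewrite sum1_card /F'.
by case: ifP; rewrite ?cards0.
Qed.

(** The walks continuing [d] branch like a tree: if two different first darts led to the same
    vertex, one walk reversed and followed by the other would be a short cycle. *)
Lemma leq_card_reachable A k D l d : no_short_cycle A k.*2 -> l <= k ->
  (forall d, d.1 \in A -> D <= #|dart_next A d|) -> d.1 \in A ->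
  D ^ l <= #|reachable A l d|.
Proof.
move=> cyc lek deg; elim: l d lek => [|l IH] d lek dA /=; first by rewrite cards1.
rewrite card_bigcup_disjoint; last first.
  move=> d1 d2 y /and3P [/eqP e1 n1 A1] /and3P [/eqP e2 n2 A2].
  move=> /reachableP [p1 [pp1 s1 y1]] /reachableP [p2 [pp2 s2 y2]].
  (* Two different darts of one edge with the same source would make that edge a loop. *)
  have [eq|neq] := eqVneq d1.1 d2.1.
    have := cyc d1 [::] A1 isT; rewrite double_gt0 => /(_ (leq_ltn_trans (leq0n _) lek)).
    have := etrans (esym e1) e2; rewrite /dart_src /dart_tgt /= => src_eq loop.
    case: (eqVneq d1.2 d2.2) => [eq2|]; first by apply: injective_projections.
    by rewrite -eq in src_eq; move: src_eq loop; case: d1.2; case: d2.2 => //= ->.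
  have [lA pr] := path_dart_rev A1 pp1.
  (* With its first dart, the closed walk has [2 * (l + 1)] darts, which is at most [2 * k]. *)
  pose q := map dart_rev (rev (belast d1 p1)) ++ d2 :: p2.
  have lq : last (dart_rev (last d1 p1)) (map dart_rev (rev (belast d1 p1))) = dart_rev d1.
    rewrite last_map; congr dart_rev; case: p1 {pp1 s1 y1 lA pr q} => //= d3 p1.
    by rewrite rev_cons last_rcons.
  have pq : path (dart_next A) (dart_rev (last d1 p1)) q.
    rewrite cat_path pr lq /= pp2 andbT /dart_next dart_tgt_rev /= neq A2 -e1 -e2.
    by rewrite eqxx.
  case: (cyc (dart_rev (last d1 p1)) q lA pq).
    by rewrite size_cat size_map size_rev size_belast /= s1 s2 -addnn -addSn leq_add.
  by rewrite last_cat /= -y2 y1.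
apply: (@leq_trans (\sum_(d' | dart_next A d d') D ^ l)).
  by rewrite sum_nat_const expnS leq_mul // deg.
apply: leq_sum => d' /and3P [_ _ A']; apply: IH => //; exact: ltnW.
Qed.

(** Otherwise take an inclusion-minimal vertex set [S] inducing more than [D * #|S|] edges. By
    minimality every vertex of [S] meets more than [D] of them, so every dart continues in at least
    [D] ways, and [k] steps reach more vertices than exist. *)
Lemma moore_bound A k D : no_short_cycle A k.*2 -> #|V| < D ^ k -> #|A| <= D * #|V|.
Proof.
move=> cyc ltV; rewrite leqNgt; apply/negP => ltA.
pose AS S := [set b in A | (ends true b \in S) && (ends false b \in S)].
pose P S := D * #|S| < #|AS S|.
have PT : P setT.
  rewrite /P cardsT; suff -> : AS setT = A by [].
  by apply/setP => b; rewrite !inE !andbT.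
have [S /minsetP [PS min] _] := minset_exists PT.
have ASA : AS S \subset A by apply/subsetP => b; rewrite inE => /andP [].
have deg d : d.1 \in AS S -> D <= #|dart_next (AS S) d|.
  move=> dA; have xS : dart_tgt d \in S.
    by move: dA; rewrite inE /dart_tgt => /and3P [_ ? ?]; case: d.2.
  set x := dart_tgt d in xS *.
  pose inc := [set b in AS S | (ends true b == x) || (ends false b == x)].
  have splitA : AS S \subset AS (S :\ x) :|: inc.
    apply/subsetP => b; rewrite !inE => /and3P [-> -> ->] /=.
    by case: eqP; case: eqP.
  have nP : ~~ P (S :\ x).
    apply/negP => /min eq; move: xS; rewrite -eq ?subD1set //.
    by rewrite in_setD1 eqxx.
  have lt_inc : D < #|inc|.
    move: nP PS; rewrite /P -leqNgt (cardsD1 x S) xS mulnDr muln1 => h1 h2.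
    rewrite -(ltn_add2r (D * #|S :\ x|)); apply: leq_trans h2 _.
    apply: leq_trans (subset_leq_card splitA) _; rewrite addnC.
    by apply: leq_trans (leq_card_setU _ _) _; rewrite leq_add2r.
  (* Directs each incident edge away from [x]. Discarding the edge of [d] itself leaves at least [D]
     of them. *)
  pose f b : B * bool := (b, ends true b == x).
  have finj : injective f by move=> b b' [].
  apply: (@leq_trans #|f @: (inc :\ d.1)|).
    by rewrite card_imset // -ltnS (leq_trans lt_inc) // (cardsD1 d.1) -add1n leq_add2r leq_b1.
  apply: subset_leq_card; apply/subsetP => _ /imsetP [b + ->].
  rewrite in_setD1 inE => /and3P [neq bA bx].
  rewrite unfold_in /dart_next /= bA andbT [d.1 == b]eq_sym neq andbT /dart_src /= eq_sym.
  by case: (eqVneq (ends true b) x) bx => //= ->.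
have /card_gt0P [b bA] : 0 < #|AS S| by apply: leq_ltn_trans PS.
have := leq_card_reachable (no_short_cycle_sub ASA cyc) (leqnn k) deg (d := (b, true)) bA.
by rewrite leqNgt => /negP; apply; apply: leq_ltn_trans (max_card _) ltV.
Qed.

End Moore.

(** * Chains of edges with short jumps *)

Lemma RlebP x y : reflect (x <= y)%Re (Rleb x y).
Proof. by rewrite /Rleb; case: Rle_dec => ?; constructor. Qed.

Lemma RltbP x y : reflect (x < y)%Re (Rltb x y).
Proof. by rewrite /Rltb; case: Rlt_dec => ?; constructor. Qed.

Section Chains.
Variables (T : finType) (w : {set T} -> nat) (H Z Q : {set {set T}}).
Variables (k : nat) (eps W : R).
Hypotheses (k_gt1 : 1 < k) (eps_gt0 : (0 < eps)%Re).
Hypotheses (conZ : connected_by Z) (ZH : Z \subset H).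
Hypothesis girthH : forall u v, [set u; v] \in H ->
  ~ reach w (H :\ [set u; v]) u v ((2 * INR k - 1) * (1 + eps) * INR (w [set u; v])).
Hypothesis QH : forall e, e \in Q -> e \in H /\ e \notin Z.
Hypothesis Qw : forall e, e \in Q -> (W <= INR (w e) <= INR k * W)%Re.
Implicit Types (e f g : T * T) (s : seq (T * T)).

Local Notation edge p := [set p.1; p.2].

(** Models consecutive edges of the cluster graph, seen in the original graph: they need only nearly
    meet, with a gap small against the heavier one. *)
Definition jump e f := (edge e != edge f) &&
  Rleb (INR (wdist Z w e.2 f.1)) (eps / 4 * Rmax (INR (w (edge e))) (INR (w (edge f)))).

Lemma jump_le e f (w0 : nat) : jump e f -> w (edge e) <= w0 -> w (edge f) <= w0 ->
  (INR (wdist Z w e.2 f.1) <= eps / 4 * INR w0)%Re.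
Proof.
move=> /andP [_ /RlebP le] /leP/le_INR le1 /leP/le_INR le2.
apply: Rle_trans le _; apply: Rmult_le_compat_l; first lra.
exact: Rmax_lub.
Qed.

Lemma reach_wdist (F : {set {set T}}) a b : Z \subset F -> reach w F a b (INR (wdist Z w a b)).
Proof. by move=> sub; apply: reach_mono sub (Rle_refl _) (wdistP w (conZ a b)).1. Qed.

Section Bounds.
Variables (F : {set {set T}}) (w0 : nat).
Hypothesis ZF : Z \subset F.
Local Notation c := (INR w0 + eps / 4 * INR w0)%Re.
Local Notation small := (fun e => (edge e \in F) && (w (edge e) <= w0)).

Lemma reach_small e : small e -> reach w F e.1 e.2 (INR w0).
Proof.
move=> /andP [eF /leP/le_INR le].
by apply: reach_mono (reach_edge w eF).
Qed.

(** Between [e] and [f] there is one more jump than there are edges; this is the additional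
    [eps / 4 * INR w0]. *)
Lemma reach_between e s f : path jump e (rcons s f) ->
  w (edge e) <= w0 -> w (edge f) <= w0 -> all small s ->
  reach w F e.2 f.1 (INR (size s) * c + eps / 4 * INR w0).
Proof.
elim: s e => [|g s IH] e; rewrite ?(S_INR (size s)) /= => /andP [je pp] le lf.
  move=> _; apply: reach_mono (reach_wdist _ _ ZF) => //.
  by have := jump_le je le lf; lra.
move=> /andP [sg al]; have lg := proj2 (andP sg).
have r := reach_trans (reach_wdist e.2 g.1 ZF) (reach_trans (reach_small sg) (IH g pp lg lf al)).
apply: reach_mono r => //; have := jump_le je le lg; lra.
Qed.

Lemma reach_from e s : path jump e s -> w (edge e) <= w0 -> all small s ->
  reach w F e.2 (last e s).2 (INR (size s) * c).
Proof.
case/lastP: s => [|s f] pp le.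
  by move=> _; apply: reach_refl; rewrite /=; lra.
rewrite all_rcons => /andP [sf al]; have lf := proj2 (andP sf).
rewrite last_rcons size_rcons S_INR.
apply: reach_mono (reach_trans (reach_between pp le lf al) (reach_small sf)) => //; lra.
Qed.

Lemma reach_to s f : sorted jump (rcons s f) -> w (edge f) <= w0 -> all small s ->
  reach w F (head f s).1 f.1 (INR (size s) * c).
Proof.
case: s => [|e s] pp lf.
  by move=> _; apply: reach_refl; rewrite /=; lra.
rewrite (S_INR (size s)) /= => /andP [se al]; have le := proj2 (andP se).
apply: reach_mono (reach_trans (reach_small se) (reach_between pp le lf al)) => //; lra.
Qed.

End Bounds.

Lemma max_weight_mem e s :
  exists2 f, f \in e :: s & forall g, g \in e :: s -> w (edge g) <= w (edge f).
Proof.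
elim: s e => [|e' s IH] e; first by exists e; rewrite ?mem_head // => g /[!inE] /eqP ->.
have [f fs max] := IH e'; have [le|lt] := leqP (w (edge e)) (w (edge f)).
  by exists f; rewrite 1?inE ?fs ?orbT // => g; rewrite inE => /predU1P [->|/max].
exists e; rewrite ?mem_head // => g; rewrite inE => /predU1P [->|/max] //.
by move=> /leq_trans; apply; apply: ltnW.
Qed.

Lemma split_has (P : pred (T * T)) s : has P s ->
  exists s1 f s2, [/\ s = s1 ++ f :: s2, P f & ~~ has P s1].
Proof.
by case/split_find => f s1 s2 Pf nh; exists s1, f, s2; rewrite cat_rcons.
Qed.

(* A chain that closes up would give, at a heaviest edge used once or twice in
   the same direction, a detour that the greedy algorithm excludes; between two
   uses in opposite directions there is a shorter chain that closes up. *)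
Lemma chain_open e s : path jump e s -> all (fun g => edge g \in Q) (e :: s) ->
  size s < k.*2 -> ~ (INR (wdist Z w (last e s).2 e.1) <= eps / 2 * (INR k * W))%Re.
Proof.
have [m] := ubnP (size s); elim: m e s => // m IH e s; rewrite ltnS => lem.
move=> pp al lek close.
have [f0 f0s max] := max_weight_mem e s.
pose P g := edge g == edge f0.
have : has P (e :: s) by apply/hasP; exists f0 => //; apply: eqxx.
case/split_has => s1 [f [s2 [def Pf nP1]]].
have ef := eqP Pf.
have {}max g : g \in e :: s -> w (edge g) <= w (edge f) by rewrite ef; apply: max.
have fQ : edge f \in Q by apply: (allP al); rewrite def mem_cat mem_head orbT.
have [fH fZ] := QH fQ; have [Wf fW] := Qw fQ.
pose F := H :\ edge f.
have ZF : Z \subset F by rewrite subsetD1 ZH.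
have small s' : {subset s' <= e :: s} -> ~~ has P s' ->
    all (fun g => (edge g \in F) && (w (edge g) <= w (edge f))) s'.
  move=> sub /hasPn nP; apply/allP => g gs; rewrite max ?sub // andbT in_setD1.
  by rewrite ef; rewrite (nP _ gs); apply: (QH (allP al _ (sub _ gs))).1.
have k2 : (2 <= INR k)%Re by have /leP/le_INR := k_gt1; rewrite /=; lra.
have w0 := pos_INR (w (edge f)).
have size_def : size s1 + size s2 = size s.
  by have := congr1 size def; rewrite size_cat /= addnS => -[].
have sizeR (m1 : nat) : m1 < k.*2 -> (INR m1 <= 2 * INR k - 1)%Re.
  by rewrite -addnn -addn1 => /leP/le_INR; rewrite !plus_INR /=; lra.
have srt : sorted jump (s1 ++ f :: s2) by rewrite -def.
have sub1 : {subset s1 <= e :: s} by move=> g gs; rewrite def mem_cat gs.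
have sub2 : {subset s2 <= e :: s} by move=> g gs; rewrite def mem_cat inE gs !orbT.
have ew0 : (0 <= eps * INR (w (edge f)))%Re by apply: Rmult_le_pos => //; lra.
have c0 : (0 <= INR (w (edge f)) + eps / 4 * INR (w (edge f)))%Re by lra.
have pf : path jump f s2.
  by have := srt; case: (s1) => [|g s1'] //=; rewrite cat_path => /andP [_ /= /andP []].
(* In the case of a single use, the other edges, at most 2k - 1, cost with their jumps at most (2k -
   1)(1 + eps/4) w(f), and the closing walk in [Z] at most (eps/2) k w(f). The sum is within (2k -
   1)(1 + eps) w(f). *)
have [has2|nP2] := boolP (has P s2); last first.
  have sf : sorted jump (rcons s1 f).
    by move: srt; rewrite -cat_rcons => /cat_sorted2 [].
  have r1 := reach_to ZF sf (leqnn _) (small _ sub1 nP1).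
  have r2 := reach_from ZF pf (leqnn _) (small _ sub2 nP2).
  have hd : head f s1 = e by have := congr1 (head f) def; case: (s1).
  have ls : last f s2 = last e s by have := congr1 (last f) def; rewrite last_cat.
  rewrite hd in r1; rewrite ls in r2.
  have r := reach_trans (reach_trans r2 (reach_wdist _ _ ZF)) r1.
  apply: (girthH fH); apply: reach_sym; apply: reach_mono r => //.
  have := sizeR _ lek; rewrite -size_def plus_INR => le.
  have := Rmult_le_compat_r _ _ _ c0 le.
  have := Rmult_le_compat_l (eps * INR k) _ _ ltac:(nra) Wf.
  have := Rmult_le_compat_r _ _ _ ew0 k2; lra.
have [s3 [f' [s4 [def2 Pf' nP3]]]] := split_has has2.
have ef' : edge f' = edge f by rewrite ef; apply/eqP.
have sub3 : {subset s3 <= e :: s}.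
  by move=> g gs; apply: sub2; rewrite def2 mem_cat gs.
have pf' : path jump f (rcons s3 f').
  by move: pf; rewrite def2 -cat_rcons cat_path => /andP [].
have le3 : (size s3).+2 <= size s1 + size s2 + 1.
  rewrite def2 size_cat /= addn1 ltnS !addnS ltnS addnA.
  by apply: leq_trans (leq_addr _ _); apply: leq_addl.
have [[same _]|[opp _]] := set2_eqP ef'.
  have := reach_between ZF pf' (leqnn _) (eq_leq (congr1 w ef')) (small _ sub3 nP3).
  rewrite same => r; apply: (girthH fH); apply: reach_sym; apply: reach_mono r => //.
  have /sizeR le : (size s3).+1 < k.*2 by rewrite (leq_trans le3) // size_def addn1.
  rewrite S_INR in le; have := Rmult_le_compat_r _ _ _ c0 le.
  have := Rmult_le_compat_r _ _ _ ew0 k2; lra.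
(* With nothing in between, [f] and [f'] would be consecutive, but [jump] separates distinct edges
   only. *)
case: s3 def2 nP3 sub3 pf' le3 => [|g s3] def2 nP3 sub3 /= pf' le3.
  by move: pf'; rewrite andbT => /andP []; rewrite ef' eqxx.
have lt3 : size s3 < size s by move: le3; rewrite size_def addn1 ltnS; apply: ltnW.
move: pf'; rewrite rcons_path => /and3P [jfg pg jl].
apply: (IH g s3 _ pg) => //.
- exact: leq_trans lt3 lem.
- by apply/allP => h /sub3 hs; apply: (allP al).
- exact: ltn_trans lt3 lek.
(* Both ends of the inner chain are within (eps/4) w(f) of [f.2], so its gap is at most (eps/2) w(f)
   <= (eps/2) k W. This is where the tolerance in the statement comes from. *)
have := jump_le jfg (leqnn _) (max _ (sub3 _ (mem_head _ _))).
have := jump_le jl (max _ (sub3 _ (mem_last _ _))) (eq_leq (congr1 w ef')).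
have /leP/le_INR := wdist_triangle w (last g s3).2 f.2 g.1 conZ.
have := Rmult_le_compat_l eps _ _ ltac:(lra) fW.
rewrite opp plus_INR; lra.
Qed.

End Chains.

(** * The cluster graph *)

Definition nfloor (x : R) : nat := Z.to_nat (Int_part x).

Lemma nfloorP x : (0 <= x)%Re -> (INR (nfloor x) <= x < INR (nfloor x) + 1)%Re.
Proof.
move=> x0; have [le gt] := base_Int_part x.
have pos : (0 <= Int_part x)%Z.
  suff : (-1 < Int_part x)%Z by lia.
  by apply: lt_IZR; rewrite /=; lra.
rewrite /nfloor INR_IZR_INZ Z2Nat.id //; lra.
Qed.

(** The integer parts differ by at most m - 1, and the fractional parts by less than 1. *)
Lemma nfloor_close (a b : R) (i j m : nat) : (0 <= a)%Re -> (0 <= b)%Re ->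
  nfloor a + i = nfloor b + j -> i < m -> j < m -> (Rabs (a - b) <= INR m)%Re.
Proof.
move=> a0 b0 /(congr1 INR); rewrite !plus_INR => eq.
move=> /leP/le_INR; rewrite S_INR => im /leP/le_INR; rewrite S_INR => jm.
have := nfloorP a0; have := nfloorP b0; have := pos_INR i; have := pos_INR j.
by move=> *; apply: Rabs_le; lra.
Qed.

Lemma Rdiv_ge0 (a b : R) : (0 <= a)%Re -> (0 < b)%Re -> (0 <= a / b)%Re.
Proof.
by move=> a0 b0; apply: Rmult_le_pos => //; apply: Rlt_le; apply: Rinv_0_lt_compat.
Qed.

Lemma INR_expn (m j : nat) : INR (m ^ j) = (INR m ^ j)%Re.
Proof. by elim: j => // j IH; rewrite expnS mult_INR IH. Qed.

Section Clusters.
Variables (T : finType) (w : {set T} -> nat) (H Z Q : {set {set T}}).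
Variables (k : nat) (eps W L : R) (pos : T -> R) (r0 : T).
Hypotheses (k_gt1 : 1 < k) (eps_gt0 : (0 < eps)%Re) (W_gt0 : (0 < W)%Re).
Hypotheses (conZ : connected_by Z) (ZH : Z \subset H).
Hypothesis girthH : forall u v, [set u; v] \in H ->
  ~ reach w (H :\ [set u; v]) u v ((2 * INR k - 1) * (1 + eps) * INR (w [set u; v])).
Hypothesis QH : forall e, e \in Q -> e \in H /\ e \notin Z.
Hypothesis Qw : forall e, e \in Q -> (W <= INR (w e) <= INR k * W)%Re.
Hypothesis card_Q : forall e, e \in Q -> #|e| = 2.
Hypothesis pos_bound : forall u, (0 <= pos u <= L)%Re.
Hypothesis wdist_pos : forall u v, (INR (wdist Z w u v) <= Rabs (pos u - pos v))%Re.

(** An arbitrary fixed orientation of [e]; edges of [Q] are pairs, so the default [(r0, r0)] does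
    not arise for them. *)
Definition endpoint (c : bool) (e : {set T}) : T :=
  let p := odflt (r0, r0) [pick p : T * T | [set p.1; p.2] == e] in
  if c then p.1 else p.2.

Lemma endpointE e : e \in Q -> [set endpoint true e; endpoint false e] = e.
Proof.
move=> /card_Q /eqP/cards2P [u [v [_ def]]]; rewrite /endpoint.
by case: pickP => [p /eqP //|/(_ (u, v))]; rewrite def eqxx.
Qed.

(* An edge e of Q is represented by [copies e] parallel edges between clusters,
   the j-th one shifted by j clusters, so that its weight is counted correctly. *)
Definition copies (e : {set T}) := nfloor (INR (w e) / W).
Definition width := (eps * W / 4)%Re.
(** Twice the number [L / width] of clusters on the line, to make room for the shifts: by
    [weight_lt] these are at most [L / width] too, so [inord] in [cluster] is never out of range on
    [copy_set]. *)
Definition cluster_bound := nfloor (2 * L / width).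
Definition cluster (c : bool) (x : {set T} * 'I_k) : 'I_cluster_bound.+1 :=
  inord (nfloor (pos (endpoint c x.1) / width) + x.2).
Definition copy_set := [set x : {set T} * 'I_k | (x.1 \in Q) && (x.2 < copies x.1)].

Lemma width_gt0 : (0 < width)%Re.
Proof. by rewrite /width; have := Rmult_lt_0_compat _ _ eps_gt0 W_gt0; lra. Qed.

Lemma k_ge2 : (2 <= INR k)%Re.
Proof. by have /leP/le_INR := k_gt1; rewrite /=; lra. Qed.

Lemma copiesP e : e \in Q ->
  [/\ 0 < copies e, copies e <= k, (INR (copies e) * W <= INR (w e))%Re
    & (INR (w e) <= 2 * W * INR (copies e))%Re].
Proof.
move=> /Qw [ge1 lek].
have def : INR (w e) = (INR (w e) / W * W)%Re by field; lra.
have q1 : (1 <= INR (w e) / W)%Re.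
  by apply: (Rmult_le_reg_r W) => //; lra.
have qk : (INR (w e) / W <= INR k)%Re.
  by apply: (Rmult_le_reg_r W) => //; lra.
have [le lt] := nfloorP (Rle_trans _ _ _ Rle_0_1 q1).
rewrite -/(copies e) in le lt.
have c1 : 0 < copies e.
  by rewrite lt0n; apply/eqP => c0; rewrite c0 /= in lt; lra.
have c1R : (1 <= INR (copies e))%Re by apply: (le_INR 1); apply/leP.
split=> //.
- by apply/leP; apply: INR_le; lra.
- by rewrite def; apply: Rmult_le_compat_r; lra.
- rewrite {1}def; have := Rmult_le_compat_r W (INR (w e) / W) (2 * INR (copies e)).
  lra.
Qed.

(** [Z] is contained in [H] without [e], so the tree path is itself a detour for [e]. *)
Lemma wdist_endpoints e : e \in Q ->
  ((2 * INR k - 1) * (1 + eps) * INR (w e)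
     < INR (wdist Z w (endpoint true e) (endpoint false e)))%Re.
Proof.
move=> eQ; have [eH eZ] := QH eQ; have def := endpointE eQ.
case: (Rlt_le_dec ((2 * INR k - 1) * (1 + eps) * INR (w e))
        (INR (wdist Z w (endpoint true e) (endpoint false e)))) => // le; exfalso.
apply: (@girthH (endpoint true e) (endpoint false e)); rewrite def //.
apply: reach_mono le (reach_wdist w conZ _ _ (subxx _)).
by rewrite subsetD1 ZH.
Qed.

(** The tree distance between the ends of [e] is at most [L], but exceeds (2k - 1)(1 + eps) w(e)
    with 2k - 1 >= 3. A nonempty [Q] thus forces the clusters to be short against the line. *)
Lemma weight_lt e : e \in Q -> (3 * eps * INR (w e) < L)%Re /\ (3 * eps * W < L)%Re.
Proof.
move=> eQ; have [We _] := Qw eQ; have k2 := k_ge2.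
have lt := Rlt_le_trans _ _ _ (wdist_endpoints eQ) (wdist_pos _ _).
have b1 := pos_bound (endpoint true e); have b2 := pos_bound (endpoint false e).
have absL : (Rabs (pos (endpoint true e) - pos (endpoint false e)) <= L)%Re.
  by apply: Rabs_le; lra.
have ew : (eps * W <= eps * INR (w e))%Re by apply: Rmult_le_compat_l; lra.
have k3 : (3 * (eps * INR (w e)) <= (2 * INR k - 1) * (eps * INR (w e)))%Re.
  by apply: Rmult_le_compat_r; [have := Rmult_lt_0_compat _ _ eps_gt0 W_gt0|]; lra.
have k4 : (0 <= (2 * INR k - 1) * INR (w e))%Re by apply: Rmult_le_pos; lra.
by split; lra.
Qed.

Lemma clusterE c (x : {set T} * 'I_k) : x \in copy_set ->
  cluster c x = nfloor (pos (endpoint c x.1) / width) + x.2 :> nat.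
Proof.
rewrite inE => /andP [xQ lt]; rewrite inordK //; apply/ltP; apply: INR_lt.
have d0 := width_gt0; have [p0 pL] := pos_bound (endpoint c x.1).
have pdL : (pos (endpoint c x.1) / width <= L / width)%Re.
  by apply: Rmult_le_compat_r => //; apply: Rlt_le; apply: Rinv_0_lt_compat.
have pd0 : (0 <= pos (endpoint c x.1) / width)%Re by apply: Rdiv_ge0.
have [_ _ cW _] := copiesP xQ; have [ewL _] := weight_lt xQ.
have cL : (INR (copies x.1) <= L / width)%Re.
  apply: (Rmult_le_reg_r width) => //; rewrite /Rdiv Rmult_assoc Rinv_l; last lra.
  by have := Rmult_le_compat_l eps _ _ (Rlt_le _ _ eps_gt0) cW; rewrite /width; lra.
have L2 : (2 * L / width = L / width + L / width)%Re by field; lra.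
have /nfloorP [_] : (0 <= 2 * L / width)%Re by lra.
rewrite -/cluster_bound S_INR plus_INR => gt.
have := nfloorP pd0; move/ltP/lt_INR: lt; lra.
Qed.

(** If both shifts are below [m], sharing a cluster puts the endpoints within [m * width] on the
    line, and for [m] the larger number of copies [m * W] is at most the larger weight. *)
Lemma cluster_eq (x y : {set T} * 'I_k) c c' : x \in copy_set -> y \in copy_set ->
  cluster c x = cluster c' y ->
  (INR (wdist Z w (endpoint c x.1) (endpoint c' y.1))
     <= eps / 4 * Rmax (INR (w x.1)) (INR (w y.1)))%Re.
Proof.
move=> xA yA /(congr1 val) /=; rewrite !clusterE // => eq.
apply: Rle_trans (wdist_pos _ _) _.
move: xA yA; rewrite !inE => /andP [xQ xc] /andP [yQ yc].
have d0 := width_gt0; have px := pos_bound (endpoint c x.1).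
have py := pos_bound (endpoint c' y.1).
pose m := maxn (copies x.1) (copies y.1).
have close := @nfloor_close _ _ _ _ m (Rdiv_ge0 px.1 d0)
  (Rdiv_ge0 py.1 d0) eq (leq_trans xc (leq_maxl _ _)) (leq_trans yc (leq_maxr _ _)).
have -> : (pos (endpoint c x.1) - pos (endpoint c' y.1) = width *
    (pos (endpoint c x.1) / width - pos (endpoint c' y.1) / width))%Re by field; lra.
rewrite Rabs_mult (Rabs_pos_eq width); last lra.
apply: Rle_trans (Rmult_le_compat_l _ _ _ (Rlt_le _ _ d0) close) _.
have mW : (INR m * W <= Rmax (INR (w x.1)) (INR (w y.1)))%Re.
  have [_ _ cx _] := copiesP xQ; have [_ _ cy _] := copiesP yQ.
  rewrite /m; case: (leqP (copies x.1) (copies y.1)) => _.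
    exact: Rle_trans cy (Rmax_r _ _).
  exact: Rle_trans cx (Rmax_l _ _).
by have := Rmult_le_compat_l eps _ _ (Rlt_le _ _ eps_gt0) mW; rewrite /width; lra.
Qed.

Definition dart_edge (d : ({set T} * 'I_k) * bool) : T * T :=
  (endpoint d.2 d.1.1, endpoint (~~ d.2) d.1.1).

Lemma dart_edgeE (d : ({set T} * 'I_k) * bool) :
  d.1 \in copy_set -> [set (dart_edge d).1; (dart_edge d).2] = d.1.1.
Proof.
rewrite inE => /andP [/endpointE + _]; rewrite /dart_edge.
by case: d.2 => //=; rewrite setUC.
Qed.

(** Two copies of one edge cannot be consecutive. Turning back at the same endpoint in the same
    cluster forces equal shifts, hence the same copy. Going on in the same direction would put both
    ends of the edge closer together than [wdist_endpoints] allows. *)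
Lemma dart_next_jump (d d' : ({set T} * 'I_k) * bool) :
  d.1 \in copy_set -> dart_next cluster copy_set d d' ->
  jump w Z eps (dart_edge d) (dart_edge d').
Proof.
move=> dA /and3P [/eqP eq neq dA']; rewrite /jump !dart_edgeE //.
apply/andP; split; last by apply/RlebP; apply: cluster_eq.
apply/negP => /eqP eq1.
have dQ : d.1.1 \in Q by move: dA; rewrite inE => /andP [].
have [dir|dir] := eqVneq d'.2 (~~ d.2).
  move/(congr1 val): eq; rewrite /dart_tgt /dart_src /= !clusterE // dir eq1.
  move/addnI => eq2; case/negP: neq; apply/eqP.
  by apply: injective_projections => //; apply: val_inj.
have := cluster_eq dA dA' eq; have := wdist_endpoints dQ.
have {dir} -> : d'.2 = d.2 by move: dir; case: d'.2; case: d.2.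
rewrite -eq1 Rmax_left; last exact: Rle_refl.
have -> : wdist Z w (endpoint (~~ d.2) d.1.1) (endpoint d.2 d.1.1) =
    wdist Z w (endpoint true d.1.1) (endpoint false d.1.1).
  by case: d.2 => //=; apply: wdistC.
have k2 := k_ge2; have w0 : (0 <= INR (w d.1.1))%Re := pos_INR _.
have ew := Rmult_le_pos _ _ (Rlt_le _ _ eps_gt0) w0.
have := Rmult_le_compat_r _ _ _ ew k2; have := Rmult_le_compat_r _ _ _ w0 k2; lra.
Qed.

(** A short cycle becomes a chain of jumps whose gap is at most (eps/4) k W, which [chain_open]
    excludes. *)
Lemma clusters_no_short_cycle : no_short_cycle cluster copy_set k.*2.
Proof.
move=> d p dA pp lt close.
have : path (jump w Z eps) (dart_edge d) (map dart_edge p) /\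
       all (fun x => [set x.1; x.2] \in Q) (map dart_edge (d :: p)) /\
       (last d p).1 \in copy_set.
  have memQ d' : d'.1 \in copy_set -> [set (dart_edge d').1; (dart_edge d').2] \in Q.
    by move=> d'A; rewrite dart_edgeE //; move: d'A; rewrite inE => /andP [].
  elim: p d dA pp {lt close} => [|d' p IH] d dA /=; first by rewrite memQ.
  move=> /andP [nx pp]; have /and3P [_ _ d'A] := nx.
  have [p1 [p2 p3]] := IH d' d'A pp.
  by rewrite (dart_next_jump dA nx) p1 memQ.
case=> pj [al lA].
apply: (chain_open k_gt1 eps_gt0 conZ ZH girthH QH Qw pj al); rewrite ?size_map //.
rewrite last_map; apply: Rle_trans (cluster_eq lA dA (esym close)) _.
have lQ : (last d p).1.1 \in Q by move: lA; rewrite inE => /andP [].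
have dQ : d.1.1 \in Q by move: dA; rewrite inE => /andP [].
have := Rmax_lub _ _ _ (Qw lQ).2 (Qw dQ).2.
move=> /(Rmult_le_compat_l (eps / 4) _ _ ltac:(lra)) maxle; apply: Rle_trans maxle _.
have := Rmult_lt_0_compat _ _ eps_gt0 W_gt0; have := k_ge2 => k2 eW.
have := Rmult_le_compat_r _ _ _ (Rlt_le _ _ eW) k2.
lra.
Qed.

Lemma card_copy_set : #|copy_set| = \sum_(e in Q) copies e.
Proof.
rewrite -sum1_card.
rewrite (eq_bigl (fun x : {set T} * 'I_k => (x.1 \in Q) && (x.2 < copies x.1))); last first.
  by move=> x; rewrite inE.
rewrite -(pair_big_dep (mem Q) (fun e (j : 'I_k) => j < copies e) (fun _ _ => 1)) /=.
apply: eq_bigr => e eQ; have [_ lek _ _] := copiesP eQ.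
by rewrite -(big_ord_widen_cond k predT (fun=> 1)) // sum_nat_const card_ord muln1.
Qed.

Lemma wset_copies : (INR (wset w Q) <= 2 * W * INR #|copy_set|)%Re.
Proof.
rewrite card_copy_set /wset.
apply: (big_ind2 (fun a b : nat => (INR a <= 2 * W * INR b)%Re)) => [|a b c d h1 h2|e eQ].
- rewrite /=; lra.
- rewrite !plus_INR; lra.
- by have [] := copiesP eQ.
Qed.

(** The Moore bound is applied to O(L / (W eps)) clusters, and W (L / (W eps))^(1 + 1/k) = L
    (L/W)^(1/k) / eps^(1 + 1/k). The constant is 2 * 2 * 144: rounding weights to copies, rounding
    [D], and 12^(1 + 1/k) <= 144. *)
Lemma wset_bound : (0 <= L)%Re ->
  (INR (wset w Q) <= 576 * L * Rpower (L / W) (1 / INR k) / Rpower eps (1 + 1 / INR k))%Re.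
Proof.
move=> L0; set x := (1 / INR k)%Re; have k2 := k_ge2.
have Rp0 a b : (0 < Rpower a b)%Re by apply: exp_pos.
have [Q0|[e eQ]] := set_0Vmem Q.
  rewrite Q0 /wset big_set0; apply: Rdiv_ge0 => //.
  by apply: Rmult_le_pos; [lra | apply: Rlt_le].
have [_ WL] := weight_lt eQ; have eW := Rmult_lt_0_compat _ _ eps_gt0 W_gt0.
have x0 : (0 < x)%Re by apply: Rdiv_lt_0_compat; lra.
have x1 : (x <= 1)%Re.
  by apply: (Rmult_le_reg_r (INR k)); rewrite /x; [lra | field_simplify; lra].
have kx : (x * INR k = 1)%Re by rewrite /x; field; lra.
have d0 := width_gt0.
pose m := cluster_bound.+1.
have m1 : (1 <= INR m)%Re by apply: (le_INR 1); apply/leP.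
(* [m] is at most [2 * L / width + 1], hence at most [3 * L / width], because [weight_lt] gives
   [L / width >= 1]. *)
have m_le : (INR m <= 12 * (L / W) * / eps)%Re.
  have qd : (L / width = 4 * (L / W) * / eps)%Re by rewrite /width; field; lra.
  have q1 : (1 <= L / width)%Re.
    apply: (Rmult_le_reg_r width) => //; rewrite /Rdiv Rmult_assoc Rinv_l; last lra.
    by rewrite /width; lra.
  have L2 : (2 * L / width = L / width + L / width)%Re by field; lra.
  have /nfloorP [+ _] : (0 <= 2 * L / width)%Re by lra.
  rewrite -/cluster_bound /m S_INR; lra.
(* The successor makes D^k strictly larger than m; since m >= 1, still D <= 2 m^(1/k). *)
pose D := (nfloor (Rpower (INR m) x)).+1.
have [D_le D_gt] := nfloorP (Rlt_le _ _ (Rp0 (INR m) x)).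
have mx1 : (1 <= Rpower (INR m) x)%Re.
  by rewrite -(Rpower_O (INR m)); [apply: Rle_Rpower|]; lra.
have ltD : #|'I_m| < D ^ k.
  rewrite card_ord; apply/ltP; apply: INR_lt; rewrite INR_expn -Rpower_pow; last first.
    by apply: lt_0_INR; apply/ltP.
  rewrite -{1}(Rpower_1 (INR m)); last lra.
  rewrite -kx -Rpower_mult; apply: Rlt_Rpower_l; first lra.
  by split=> //; rewrite /D S_INR.
have /leP/le_INR := moore_bound clusters_no_short_cycle ltD.
rewrite card_ord mult_INR => N_le.
have N_le2 : (INR #|copy_set| <= 2 * Rpower (12 * (L / W) * / eps) (1 + x))%Re.
  apply: Rle_trans N_le _.
  apply: (@Rle_trans _ (2 * Rpower (INR m) (1 + x))); last first.
    by apply: Rmult_le_compat_l; [lra | apply: Rle_Rpower_l; lra].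
  rewrite Rpower_plus Rpower_1; last lra.
  have : (INR D <= 2 * Rpower (INR m) x)%Re by rewrite /D S_INR; lra.
  by move=> /(Rmult_le_compat_r (INR m)); rewrite -/m; lra.
have q0 : (0 < L / W)%Re by apply: Rdiv_lt_0_compat; lra.
have ie0 := Rinv_0_lt_compat _ eps_gt0.
have ex : Rpower (/ eps) (1 + x) = (/ Rpower eps (1 + x))%Re.
  by rewrite /Rpower ln_Rinv // -exp_Ropp; congr exp; ring.
have expand : Rpower (12 * (L / W) * / eps) (1 + x) = (Rpower 12 (1 + x) *
    (L / W * Rpower (L / W) x) * / Rpower eps (1 + x))%Re.
  rewrite -ex -{2}(Rpower_1 (L / W)) // -Rpower_plus.
  rewrite !Rpower_mult_distr //; lra.
rewrite expand in N_le2.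
have p12 : (Rpower 12 (1 + x) <= 144)%Re.
  apply: (@Rle_trans _ (Rpower 12 (INR 2))); last by rewrite Rpower_pow /=; lra.
  by apply: Rle_Rpower; rewrite /=; lra.
have LWq : (L = W * (L / W))%Re by field; lra.
apply: Rle_trans wset_copies _; rewrite /Rdiv.
pose B := (L / W * Rpower (L / W) x * / Rpower eps (1 + x))%Re.
have B0 : (0 <= B)%Re.
  apply: Rmult_le_pos; last by apply: Rlt_le; apply: Rinv_0_lt_compat.
  by apply: Rmult_le_pos; apply: Rlt_le.
have -> : (576 * L * Rpower (L * / W) x * / Rpower eps (1 + x) = 2 * W * (2 * (144 * B)))%Re.
  by rewrite {1}LWq /B /Rdiv; ring.
apply: Rmult_le_compat_l; first lra.
apply: Rle_trans N_le2 _; apply: Rmult_le_compat_l; first lra.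
rewrite Rmult_assoc -/B; exact: Rmult_le_compat_r.
Qed.

End Clusters.

(** * Positions along the tour *)

Section Tour.
Variables (T : finType) (w : {set T} -> nat) (Z : {set {set T}}) (r : T) (ord : seq T).
Hypotheses (conZ : connected_by Z) (ordP : perm_eq ord (enum T)).

Definition tour_length m :=
  \sum_(1 <= j < m) wdist Z w (nth r ord j.-1) (nth r ord j).
(** The successor includes the step arriving at [u]; the first vertex gets position 0. *)
Definition tour_pos u := tour_length (index u ord).+1.

Lemma tour_length_step i d : wdist Z w (nth r ord i) (nth r ord (i + d))
  + tour_length i.+1 <= tour_length (i + d).+1.
Proof.
elim: d => [|d IH]; first by rewrite addn0 wdist_self.
rewrite /tour_length addnS [X in _ <= X]big_nat_recr //=.
apply: leq_trans (leq_add IH (leqnn _)).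
by rewrite addnAC leq_add2r wdist_triangle.
Qed.

Lemma mem_tour u : u \in ord.
Proof. by rewrite (perm_mem ordP) mem_enum. Qed.

Lemma tour_pos_le u : tour_pos u <= tour_length #|T|.
Proof.
have lt : index u ord < #|T|.
  by rewrite cardE -(perm_size ordP) index_mem mem_tour.
rewrite /tour_pos /tour_length [X in _ <= X](big_cat_nat (n := (index u ord).+1)) //.
exact: leq_addr.
Qed.

Lemma wdist_tour u v : (INR (wdist Z w u v) <= Rabs (INR (tour_pos u) - INR (tour_pos v)))%Re.
Proof.
wlog le : u v / index u ord <= index v ord => [sym|].
  have [le|/ltnW le] := leqP (index u ord) (index v ord); first exact: sym.
  by rewrite wdistC // Rabs_minus_sym; apply: sym.
have := tour_length_step (index u ord) (index v ord - index u ord).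
rewrite subnKC // !nth_index ?mem_tour // => /leP/le_INR; rewrite plus_INR => le2.
rewrite Rabs_minus_sym; apply: Rle_trans (Rle_abs _); rewrite /tour_pos; lra.
Qed.

End Tour.

(** * Weight classes of the greedy output *)

Theorem theorem2 :
  exists C : R, (0 < C)%Re /\
  forall (T : finType) (E : {set {set T}}) (w : {set T} -> nat) (Z : {set {set T}})
         (k : nat) (eps : R) (s : seq (T * T)) (r : T) (ord : seq T) (i : nat),
    (forall e, e \in E -> #|e| = 2) ->
    (forall e, e \in E -> 0 < w e)%N ->
    (forall u v, connect (adj E) u v) ->
    unique_mst E w Z ->
    (2 <= k)%N ->
    (0 < eps)%Re ->
    greedy_order E w s ->
    preorder Z r ord ->
    let n := #|T| in
    let t := ((2 * INR k - 1) * (1 + eps))%Re in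
    let H := greedy w t s in
    let L := (\sum_(1 <= j < n) wdist Z w (nth r ord j.-1) (nth r ord j))%N in
    (1 <= i <= up_log k n)%N ->
    let Ei := [set e in H | (e \notin Z)
                 && Rltb (INR (k ^ i.-1) * INR L / INR n) (INR (w e))
                 && Rleb (INR (w e)) (INR (k ^ i) * INR L / INR n)] in
    (INR (wset w Ei) <=
       C * INR L * Rpower (INR n / INR (k ^ i.-1)) (1 / INR k)
         / Rpower eps (1 + 1 / INR k))%Re.
Proof.
exists 576%Re; split; first lra.
move=> T E w Z k eps s r ord i cardE _ _ mst k2 eps0 greedyE [ordP _ _] n t H L /andP [i1 _] Ei.
have conZ : connected_by Z by case: mst => -[].
have n0 : (0 < INR n)%Re by apply: lt_0_INR; apply/ltP/card_gt0P; exists r.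
have k2R : (2 <= INR k)%Re by have /leP/le_INR := k2; rewrite /=; lra.
have kp0 j : (0 < INR (k ^ j))%Re by rewrite INR_expn; apply: pow_lt; lra.
have ZH : Z \subset H := mst_sub_greedy t mst greedyE.
have t1 : (1 <= t)%Re.
  have : (1 * 1 <= t)%Re by apply: Rmult_le_compat; lra.
  lra.
have girthH := greedy_girth t1 greedyE.2.
have HE e : e \in H -> e \in E.
  move=> /(subsetP (greedy_sub _ _ _)) /imsetP [p ps ->].
  by rewrite -mem_enum -(perm_mem greedyE.1); apply/mapP; exists p.
have L0 := pos_INR L.
(* For [L = 0] the weight interval is empty; this case is separate because the clusters need a
   positive [W]. *)
have [Lz|/lt0n_neq0] := posnP L.
  suff -> : Ei = set0 by rewrite /wset big_set0 Lz /=; apply: Req_le; rewrite /Rdiv; ring.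
  apply/setP => e; rewrite !inE Lz /=; apply/negP.
  move=> /andP [_ /andP [/andP [_ /RltbP lt] /RlebP le]].
  rewrite /Rdiv Rmult_0_r Rmult_0_l in lt le; lra.
rewrite -lt0n => /ltP/lt_0_INR Lgt0.
(* The lower end of the weight class; the upper end is [k * W], and n / k^(i-1) becomes L / W. *)
pose W := (INR (k ^ i.-1) * INR L / INR n)%Re.
have W0 : (0 < W)%Re by apply: Rdiv_lt_0_compat => //; apply: Rmult_lt_0_compat.
have -> : (INR n / INR (k ^ i.-1) = INR L / W)%Re.
  by rewrite /W; field; have := kp0 i.-1; lra.
have EiP e : e \in Ei -> [/\ e \in H, e \notin Z & (W <= INR (w e) <= INR k * W)%Re].
  rewrite inE => /andP [eH /andP [/andP [eZ /RltbP lt] /RlebP le]]; split=> //.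
  split; first exact: Rlt_le.
  apply: Rle_trans le _; apply: Req_le.
  by rewrite -{1}(prednK i1) expnS mult_INR /W /Rdiv; ring.
apply: (@wset_bound _ w H Z Ei k eps W (INR L) (fun u => INR (tour_pos w Z r ord u)) r) => //.
- by move=> e /EiP [].
- by move=> e /EiP [].
- by move=> e /EiP [/HE /cardE].
- move=> u; split; first exact: pos_INR.
  by apply: le_INR; apply/leP; apply: tour_pos_le.
- exact: wdist_tour.
Qed.
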